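(* If $\mathbb V$ is infinite, then every LIF expression is equivalent to a LIFnc expression, i.e., to a LIF expression in which the composition operator $;$ does not occur.
   Context: **Basic setting.** Fix a vocabulary $\mathcal S$: a nonempty set of module names, each module name $M$ having an arity $ar(M)$ and an input arity $iar(M)\le ar(M)$ (natural numbers). Fix a countably infinite set $\mathbf{dom}$. An interpretation $D$ of $\mathcal S$ assigns to each module name $M$ an $ar(M)$-ary relation $D(M)$ over $\mathbf{dom}$. $\mathbb V$ is a fixed set of variables. A valuation is a function $\mathbb V\to\mathbf{dom}$; $\mathcal V$ is the set of all valuations. Valuations agree on $Y\subseteq\mathbb V$ if they have equal values on every $y\in Y$; they agree outside $Y$ if they agree on $\mathbb V- Y$. A BRV is a subset of $\mathcal V\times\mathcal V$. **Operations on BRVs** $A,B$ ($Z$ a finite set of variables; $x,y$ variables): union, intersection, set difference $A-B$; composition $A;B=\{(\nu_1,\nu_2)\mid\exists\nu_3:(\nu_1,\nu_3)\in A,(\nu_3,\nu_2)\in B\}$; converse $A^{-1}=\{(\nu_1,\nu_2)\mid(\nu_2,\nu_1)\in A\}$; left cylindrification $\mathrm{cyl}^l_Z(A)=\{(\nu_1,\nu_2)\mid\exists\nu_1':(\nu_1',\nu_2)\in A,\ \nu_1'\text{ and }\nu_1\text{ agree outside }Z\}$; right cylindrification $\mathrm{cyl}^r_Z(A)=\{(\nu_1,\nu_2)\mid\exists\nu_2':(\nu_1,\nu_2')\in A,\ \nu_2'\text{ and }\nu_2\text{ agree outside }Z\}$; selections $\sigma^l_{x=y}(A)=\{(\nu_1,\nu_2)\in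 A\mid\nu_1(x)=\nu_1(y)\}$, $\sigma^r_{x=y}(A)=\{(\nu_1,\nu_2)\in A\mid\nu_2(x)=\nu_2(y)\}$, $\sigma^{lr}_{x=y}(A)=\{(\nu_1,\nu_2)\in A\mid\nu_1(x)=\nu_2(y)\}$. **LIF expressions** over $\mathcal S$ are generated by $\alpha::=\mathit{id}\mid M(\bar x;\bar y)\mid\alpha\cup\alpha\mid\alpha\cap\alpha\mid\alpha-\alpha\mid\alpha;\alpha\mid\alpha^{-1}\mid\mathrm{cyl}^l_Z(\alpha)\mid\mathrm{cyl}^r_Z(\alpha)\mid\sigma^{lr}_{x=y}(\alpha)\mid\sigma^l_{x=y}(\alpha)\mid\sigma^r_{x=y}(\alpha)$, where in an atomic module expression $M(\bar x;\bar y)$ the tuples of variables $\bar x,\bar y$ have lengths $iar(M)$ and $ar(M)-iar(M)$. LIFnc is the fragment of LIF without the operator $;$. Semantics: $[\![\mathit{id}]\!]_D=\{(\nu,\nu)\mid\nu\in\mathcal V\}$; $[\![M(\bar x;\bar y)]\!]_D=\{(\nu_1,\nu_2)\mid\nu_1(\bar x)\cdot\nu_2(\bar y)\in D(M)\text{ and }\nu_1,\nu_2\text{ agree outside }\bar y\}$ ($\cdot$ is concatenation of tuples); the other operators are interpreted by the corresponding BRV operations. Two LIF expressions $\alpha,\beta$ are equivalent if $[\![\alpha]\!]_D=[\![\beta]\!]_D$ for every interpretation $D$. *)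

(* Defs.v *)
From mathcomp Require Import all_boot finmap.
From mathcomp Require Import boolp classical_sets functions cardinality.

Set Implicit Arguments.
Unset Strict Implicit.
Unset Printing Implicit Defensive.

Local Open Scope classical_set_scope.

Record vocabulary := Vocabulary {
  mname :> Type;
  mname_inhabited : inhabited mname;
  arity : mname -> nat;
  iarity : mname -> nat;
  iarity_le : forall M, iarity M <= arity M
}.

Definition interpretation (S : vocabulary) (dom : Type) :=
  forall M : S, set ((arity M).-tuple dom).

Definition valuation (V dom : Type) := V -> dom.

Section BRV.
Variables (V : choiceType) (dom : Type).

Definition agree_on (Y : set V) (nu1 nu2 : valuation V dom) : Prop :=
  forall y, Y y -> nu1 y = nu2 y.

Definition agree_outside (Y : set V) (nu1 nu2 : valuation V dom) : Prop :=
  agree_on (~` Y) nu1 nu2.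

Definition brv := set (valuation V dom * valuation V dom).

Definition brv_id : brv := [set p | p.1 = p.2].

Definition brv_comp (A B : brv) : brv :=
  [set p | exists nu3, A (p.1, nu3) /\ B (nu3, p.2)].

Definition brv_conv (A : brv) : brv := [set p | A (p.2, p.1)].

Definition brv_cyll (Z : {fset V}) (A : brv) : brv :=
  [set p | exists nu1', A (nu1', p.2) /\ agree_outside [set` Z] nu1' p.1].

Definition brv_cylr (Z : {fset V}) (A : brv) : brv :=
  [set p | exists nu2', A (p.1, nu2') /\ agree_outside [set` Z] nu2' p.2].

Definition brv_sell (x y : V) (A : brv) : brv :=
  [set p | A p /\ p.1 x = p.1 y].

Definition brv_selr (x y : V) (A : brv) : brv :=
  [set p | A p /\ p.2 x = p.2 y].

Definition brv_sellr (x y : V) (A : brv) : brv :=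
  [set p | A p /\ p.1 x = p.2 y].

End BRV.

Inductive lif (S : vocabulary) (V : choiceType) : Type :=
| LId
| LMod (M : S) (xs : (iarity M).-tuple V) (ys : (arity M - iarity M).-tuple V)
| LUnion (a b : lif S V)
| LInter (a b : lif S V)
| LDiff (a b : lif S V)
| LComp (a b : lif S V)
| LConv (a : lif S V)
| LCylL (Z : {fset V}) (a : lif S V)
| LCylR (Z : {fset V}) (a : lif S V)
| LSelLR (x y : V) (a : lif S V)
| LSelL (x y : V) (a : lif S V)
| LSelR (x y : V) (a : lif S V).

Arguments LId {S V}.

(* The cast identifies the lengths iarity M + (arity M - iarity M) and arity M
   and leaves the underlying sequence unchanged. *)
Definition brv_mod (S : vocabulary) (V : choiceType) (dom : Type)
    (D : interpretation S dom) (M : S)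
    (xs : (iarity M).-tuple V) (ys : (arity M - iarity M).-tuple V) :
    brv V dom :=
  [set p | D M (tcast (subnKC (iarity_le M))
                      [tuple of map p.1 xs ++ map p.2 ys])
           /\ agree_outside [set` ys] p.1 p.2].

Fixpoint sem (S : vocabulary) (V : choiceType) (dom : Type)
    (D : interpretation S dom) (a : lif S V) : brv V dom :=
  match a with
  | LId => @brv_id V dom
  | LMod M xs ys => brv_mod D xs ys
  | LUnion a b => sem D a `|` sem D b
  | LInter a b => sem D a `&` sem D b
  | LDiff a b => sem D a `\` sem D b
  | LComp a b => brv_comp (sem D a) (sem D b)
  | LConv a => brv_conv (sem D a)
  | LCylL Z a => brv_cyll Z (sem D a)
  | LCylR Z a => brv_cylr Z (sem D a)
  | LSelLR x y a => brv_sellr x y (sem D a)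
  | LSelL x y a => brv_sell x y (sem D a)
  | LSelR x y a => brv_selr x y (sem D a)
  end.

Definition lif_equiv (S : vocabulary) (V : choiceType) (dom : Type)
    (a b : lif S V) : Prop :=
  forall D : interpretation S dom, sem D a = sem D b.

Fixpoint is_lifnc (S : vocabulary) (V : choiceType) (a : lif S V) : bool :=
  match a with
  | LId | LMod _ _ _ => true
  | LUnion a b | LInter a b | LDiff a b => is_lifnc a && is_lifnc b
  | LComp _ _ => false
  | LConv a | LCylL _ a | LCylR _ a
  | LSelLR _ _ a | LSelL _ _ a | LSelR _ _ a => is_lifnc a
  end.

(* Main.v *)
(* To eliminate a composition [a ; b], store the intermediate valuation in
   fresh variables. Let [W] be finite such that both [a] and [b] relate only
   valuations that agree outside [W], and let [f] map [W] injectively to a set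
   [U] disjoint from [W]. Without composition one can express that the first
   valuation is sent by [a] to the values stored in [U] on the right, and that
   these values are sent by [b] to the second valuation. Projecting out [U] and
   restoring agreement outside [W] yields [a ; b]. *)
Require Import Defs.
From mathcomp Require Import all_boot finmap.
From mathcomp Require Import boolp classical_sets functions cardinality.

Set Implicit Arguments.
Unset Strict Implicit.
Unset Printing Implicit Defensive.

Local Open Scope classical_set_scope.
Local Open Scope card_scope.

Lemma agree_outsideP (V : choiceType) (dom : Type) (W : {fset V})
    (nu1 nu2 : valuation V dom) :
  agree_outside [set` W] nu1 nu2 <-> (forall x, x \notin W -> nu1 x = nu2 x).
Proof. by split=> h x hx; apply: h; apply/negP. Qed.

Lemma agree_outside_sub (V : choiceType) (dom : Type) (Y Z : set V)
    (nu1 nu2 : valuation V dom) :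
  Y `<=` Z -> agree_outside Y nu1 nu2 -> agree_outside Z nu1 nu2.
Proof. by move=> YZ h y Zy; apply: h => /YZ. Qed.

(** Only module outputs and cylindrified variables can change, and an expression mentions finitely
    many of them. For intersection and difference the left operand already gives a bound. The set
    [W] is chosen before [D], so an expression built from it can serve all interpretations at
    once. *)
Lemma lif_inertia (S : vocabulary) (V : choiceType) (dom : Type)
    (a : lif S V) :
  exists W : {fset V}, forall (D : interpretation S dom) nu1 nu2,
    sem D a (nu1, nu2) -> agree_outside [set` W] nu1 nu2.
Proof.
elim: a => [|M xs ys|a [A hA] b [B hB]|a [A hA] b _|a [A hA] b _
  |a [A hA] b [B hB]|a [A hA]|Z a [A hA]|Z a [A hA]|x y a [A hA]
  |x y a [A hA]|x y a [A hA]].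
- by exists fset0 => D nu1 nu2; rewrite /= /brv_id /= => ->.
- exists [fset y in (ys : seq V)]%fset => D nu1 nu2 [_].
  by apply: agree_outside_sub => y /= hy; rewrite inE.
- exists (A `|` B)%fset => D nu1 nu2 [/hA|/hB];
    apply: agree_outside_sub => x /= hx; by rewrite inE hx ?orbT.
- by exists A => D nu1 nu2 [/hA].
- by exists A => D nu1 nu2 [/hA].
- exists (A `|` B)%fset => D nu1 nu2 [nu3 [/= /hA/agree_outsideP h1]].
  move=> /hB/agree_outsideP h2; apply/agree_outsideP => x.
  by rewrite inE negb_or => /andP[hx1 hx2]; rewrite h1 ?h2.
- exists A => D nu1 nu2 /hA/agree_outsideP h.
  by apply/agree_outsideP => x /h.
- exists (A `|` Z)%fset => D nu1 nu2 [nu3 [/= /hA/agree_outsideP h1]].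
  move=> /agree_outsideP h2; apply/agree_outsideP => x.
  by rewrite inE negb_or => /andP[hx1 hx2]; rewrite -h2 ?h1.
- exists (A `|` Z)%fset => D nu1 nu2 [nu3 [/= /hA/agree_outsideP h1]].
  move=> /agree_outsideP h2; apply/agree_outsideP => x.
  by rewrite inE negb_or => /andP[hx1 hx2]; rewrite h1 ?h2.
- by exists A => D nu1 nu2 [/hA].
- by exists A => D nu1 nu2 [/hA].
- by exists A => D nu1 nu2 [/hA].
Qed.

Lemma fresh_renaming (V : choiceType) (W : {fset V}) :
  infinite_set [set: V] ->
  exists f g : V -> V, forall w, w \in W -> f w \notin W /\ g (f w) = w.
Proof.
move=> Vinf.
have Winf : infinite_set ([set: V] `\` [set` W]).
  exact: infinite_setD.
have [B BW sB] := infinite_set_fset #|` W| Winf.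
(* The enumerations of [W] and [B] are matched position by position. Since [B] has at least as many
   elements as [W], the defaults of [nth] are never reached for [w] in [W]. *)
exists (fun w => nth w B (index w W)), (fun u => nth u W (index u B)) => w wW.
have iB : index w W < #|` B| by apply: leq_trans sB; rewrite index_mem.
split; first by have /BW[_ /negP] := mem_nth w iB.
by rewrite index_uniq ?fset_uniq //= (set_nth_default w) ?index_mem // nth_index.
Qed.

Section CompositionElimination.
Variables (S : vocabulary) (V : choiceType).

Definition LSelRs (f : V -> V) (s : seq V) (a : lif S V) : lif S V :=
  foldr (fun w c => LSelR w (f w) c) a s.

Definition LSelLRs (f : V -> V) (s : seq V) (a : lif S V) : lif S V :=
  foldr (fun w c => LSelLR w (f w) c) a s.

(** In each half, [LCylR U] frees [U] on the right, the selections force it to hold a copy of the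
    intermediate values on [W], and the outer cylindrification forgets those values on [W] itself.
    [LCylL W LId] is the relation of agreement outside [W]. *)
Definition comp_elim (W : {fset V}) (f : V -> V) (a b : lif S V) : lif S V :=
  let U := [fset f w | w in W]%fset in
  let stored_by_a := LCylR W (LSelRs f W (LCylR U a)) in
  let sent_by_b := LCylL W (LSelLRs f W (LCylR U b)) in
  LInter (LCylR U (LInter stored_by_a sent_by_b)) (LCylL W LId).

Lemma is_lifnc_comp_elim W f a b :
  is_lifnc a -> is_lifnc b -> is_lifnc (comp_elim W f a b).
Proof.
move=> ha hb; rewrite /= !andbT /LSelRs /LSelLRs.
by apply/andP; split; elim: (enum_fset W).
Qed.

Variables (dom : Type) (D : interpretation S dom).

Lemma sem_LSelRs f s a nu1 nu2 :
  sem D (LSelRs f s a) (nu1, nu2) <->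
  sem D a (nu1, nu2) /\ {in s, forall w, nu2 w = nu2 (f w)}.
Proof.
elim: s => [|x s IHs] /=; first by split=> [|[]].
split=> [[/IHs[ha hs] hx]|[ha hs]].
  by split=> // w; rewrite inE => /predU1P[->|/hs].
split; last by apply: hs; rewrite mem_head.
by apply/IHs; split=> // w ws; apply: hs; rewrite inE ws orbT.
Qed.

Lemma sem_LSelLRs f s a nu1 nu2 :
  sem D (LSelLRs f s a) (nu1, nu2) <->
  sem D a (nu1, nu2) /\ {in s, forall w, nu1 w = nu2 (f w)}.
Proof.
elim: s => [|x s IHs] /=; first by split=> [|[]].
split=> [[/IHs[ha hs] hx]|[ha hs]].
  by split=> // w; rewrite inE => /predU1P[->|/hs].
split; last by apply: hs; rewrite mem_head.
by apply/IHs; split=> // w ws; apply: hs; rewrite inE ws orbT.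
Qed.

Lemma sem_comp_elim (W : {fset V}) (f g : V -> V) (a b : lif S V) :
  (forall w, w \in W -> f w \notin W /\ g (f w) = w) ->
  (forall nu1 nu2, sem D a (nu1, nu2) -> agree_outside [set` W] nu1 nu2) ->
  (forall nu1 nu2, sem D b (nu1, nu2) -> agree_outside [set` W] nu1 nu2) ->
  sem D (comp_elim W f a b) = sem D (LComp a b).
Proof.
move=> fg iA iB; rewrite /comp_elim; set U := [fset f w | w in W]%fset.
have fU w : w \in W -> f w \in U by move=> wW; apply: in_imfset.
have UW u : u \in U -> u \notin W.
  by case/imfsetP=> w /= wW ->; case: (fg _ wW).
apply/seteqP; split=> -[nu1 nu2].
  case=> -[nu2' [[]]].
  case=> [nu2a [/sem_LSelRs[[nu2b [/= ab]]]]] /agree_outsideP eab sa.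
  move=> /agree_outsideP ea.
  case=> [nu1' [/sem_LSelLRs[[nu2c [/= bc]]]]] /agree_outsideP ec sc.
  move=> /agree_outsideP e1 /agree_outsideP e2.
  case=> nu0 []; rewrite /brv_id /= => -> /agree_outsideP e12.
  have /agree_outsideP iab := iA _ _ ab.
  have /agree_outsideP ibc := iB _ _ bc.
  (* Off [U] only cylindrifications over [U] separate the two. On [U], which is disjoint from [W],
     both keep the values of [nu1]. *)
  have <- : nu2c = nu2.
    apply: funext => x; have [xU|xU] := boolP (x \in U); last by rewrite ec // e2.
    by rewrite -ibc ?UW // e1 ?UW // e12 ?UW.
  exists nu1'; split=> //=.
  (* Outside [W] both agree with [nu1]; at [w] in [W] both take the stored value [nu2' (f w)]. *)
  have -> : nu1' = nu2b.
    apply: funext => x; have [xW|xW] := boolP (x \in W); last first.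
      by rewrite e1 // iab.
    have xU : x \notin U by apply/negP => /UW; rewrite xW.
    by rewrite sc // eab // sa // ea //; case: (fg _ xW).
  by [].
case=> nu3 [/= ha hb].
have /agree_outsideP e13 := iA _ _ ha; have /agree_outsideP e32 := iB _ _ hb.
(* The final valuation, with [U] overwritten by the copy of [nu3] on [W]. *)
pose nu2' x := if x \in U then nu3 (g x) else nu2 x.
have nu2f w : w \in W -> nu2' (f w) = nu3 w.
  by move=> wW; rewrite /nu2' fU //; case: (fg _ wW) => _ ->.
split; last first.
  by exists nu2; split=> //; apply/agree_outsideP => x xW; rewrite /= e13 // e32.
exists nu2'; split; last first.
  by apply/agree_outsideP => x xU; rewrite /nu2' /= (negPf xU).
split.
  (* This valuation carries [nu3] on [W] and its copy on [U]; elsewhere it equals [nu2], hence [nu3]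
     by the inertia of [b]. *)
  exists (fun x => if x \in W then nu3 x else nu2' x); split=> /=; last first.
    by apply/agree_outsideP => x /negPf ->.
  apply/sem_LSelRs; split; last first.
    by move=> w wW; rewrite wW; case: (fg _ wW) => /negPf -> _; rewrite nu2f.
  exists nu3; split=> //; apply/agree_outsideP => x xU /=.
  by case: ifPn => // xW; rewrite /nu2' (negPf xU) e32.
exists nu3; split=> /=; last by apply/agree_outsideP => x xW; rewrite e13.
apply/sem_LSelLRs; split; last by move=> w wW; rewrite nu2f.
exists nu2; split=> //; apply/agree_outsideP => x xU.
by rewrite /nu2' /= (negPf xU).
Qed.

End CompositionElimination.

Theorem theorem7p8 (S : vocabulary) (dom : Type) (V : choiceType)
    (dom_countably_infinite : [set: dom] #= [set: nat])
    (V_infinite : infinite_set [set: V])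
    (alpha : lif S V) :
  exists beta : lif S V, is_lifnc beta /\ lif_equiv dom alpha beta.
Proof.
elim: alpha => [|M xs ys|a [a' [na ea]] b [b' [nb eb]]
  |a [a' [na ea]] b [b' [nb eb]]|a [a' [na ea]] b [b' [nb eb]]
  |a [a' [na ea]] b [b' [nb eb]]|a [a' [na ea]]|Z a [a' [na ea]]
  |Z a [a' [na ea]]|x y a [a' [na ea]]|x y a [a' [na ea]]|x y a [a' [na ea]]].
- by exists LId.
- by exists (LMod xs ys).
- by exists (LUnion a' b'); rewrite /= na nb; split=> // D /=; rewrite ea eb.
- by exists (LInter a' b'); rewrite /= na nb; split=> // D /=; rewrite ea eb.
- by exists (LDiff a' b'); rewrite /= na nb; split=> // D /=; rewrite ea eb.
(* The bounds are taken for the composition-free [a'] and [b'], from which the new expression is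
   built; their union bounds both. *)
- have [A hA] := lif_inertia dom a'; have [B hB] := lif_inertia dom b'.
  have [f [g fg]] := fresh_renaming (A `|` B)%fset V_infinite.
  exists (comp_elim (A `|` B)%fset f a' b').
  split; first exact: is_lifnc_comp_elim.
  move=> D; rewrite (sem_comp_elim fg) /= ?ea ?eb // => nu1 nu2.
    by move/hA; apply: agree_outside_sub => x /= xA; rewrite inE xA.
  by move/hB; apply: agree_outside_sub => x /= xB; rewrite inE xB orbT.
- by exists (LConv a'); split=> // D /=; rewrite ea.
- by exists (LCylL Z a'); split=> // D /=; rewrite ea.
- by exists (LCylR Z a'); split=> // D /=; rewrite ea.
- by exists (LSelLR x y a'); split=> // D /=; rewrite ea.
- by exists (LSelL x y a'); split=> // D /=; rewrite ea.
- by exists (LSelR x y a'); split=> // D /=; rewrite ea.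
Qed.
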